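(* For every $\varepsilon>0$ there exist infinitely many connected edge-weighted graphs $G$ (with weights in $\mathbb{R}_+$), each with a spanning tree $T$, such that $\mathrm{mac}(G)<\frac{w(G)}{2}+\varepsilon\, w(T)$.
   Context: $\mathbb{R}_+$ denotes the non-negative reals; for a subgraph $H$, $w(H)=\sum_{e\in E(H)}w(e)$. $\mathrm{mac}(G)$ is the maximum total weight of the edges between $A$ and $B$ over all partitions $(A,B)$ of $V(G)$. *)

(* Defs.v *)
From HB Require Import structures.
From mathcomp Require Import all_boot all_order all_algebra.
From mathcomp Require Import reals.

Set Implicit Arguments.
Unset Strict Implicit.
Unset Printing Implicit Defensive.

Import Order.TTheory GRing.Theory Num.Theory.
Local Open Scope ring_scope.

(* Finite simple graphs: an edge is a two-element set of vertices. *)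
Record sgraph := SGraph {
  vertex :> finType;
  edges : {set {set vertex}};
  edges_card2 : forall e, e \in edges -> #|e| = 2%N }.

(* Only the values of [weight] on edges matter. *)
Record wgraph (R : realType) := WGraph {
  graph_of :> sgraph;
  weight : {set graph_of} -> R;
  weight_ge0 : forall e, e \in edges graph_of -> 0 <= weight e }.

Arguments weight {R} w e.

(* A subgraph of G containing all the vertices of G is given by its set of
   edges F, which is to be a subset of [edges G]. *)
Definition adj (V : finType) (F : {set {set V}}) : rel V :=
  [rel x y | [set x; y] \in F].

Definition connected_on (V : finType) (F : {set {set V}}) : Prop :=
  (0 < #|V|)%N /\ forall x y : V, connect (adj F) x y.

(* The bound on the size discards x, y, x, which [ucycle] accepts for every
   edge xy. *)
Definition acyclic_on (V : finType) (F : {set {set V}}) : Prop :=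
  forall c : seq V, ucycle (adj F) c -> (size c < 3)%N.

Definition connected_graph (G : sgraph) : Prop := connected_on (edges G).

Definition spanning_tree (G : sgraph) (T : {set {set G}}) : Prop :=
  [/\ T \subset edges G, connected_on T & acyclic_on T].

Definition total_weight (R : realType) (G : wgraph R) (F : {set {set G}}) : R :=
  \sum_(e in F) weight G e.

Definition edges_between (G : sgraph) (A B : {set G}) : {set {set G}} :=
  [set e in edges G | [exists x in A, exists y in B, e == [set x; y]]].

(* A partition (A, B) may have an empty part; A = set0 gives the value 0, so
   the default value 0 of the maximum is attained. *)
Definition mac (R : realType) (G : wgraph R) : R :=
  \big[Num.max/0]_(A : {set G}) total_weight (edges_between A (~: A)).

Definition isomorphic (G H : sgraph) : Prop :=
  exists2 f : G -> H, bijective f &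
    forall x y : G, adj (edges H) (f x) (f y) = adj (edges G) x y.

(* Main.v *)
(** Join a hub [r] by edges of weight 1 to the [n] vertices of a complete graph
    whose edges all have weight [eps], and let [T] be the star at [r], so that
    [w(T) = n].  A cut with [s = n/2 + x] vertices on the side without [r]
    exceeds [w(G)/2] by [x - eps x^2 + eps n/4 <= 1/(4 eps) + eps n/4], which is
    less than [eps n] as soon as [n > 1/(3 eps^2)]. *)
Require Import Defs.
From HB Require Import structures.
From mathcomp Require Import all_boot all_order all_algebra.
From mathcomp Require Import reals.
From mathcomp Require Import ring.

Set Implicit Arguments.
Unset Strict Implicit.
Unset Printing Implicit Defensive.

Import Order.TTheory GRing.Theory Num.Theory.
Local Open Scope ring_scope.

Definition all_pairs (V : finType) : {set {set V}} := [set e : {set V} | #|e| == 2%N].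

Lemma all_pairs_card2 (V : finType) (e : {set V}) :
  e \in all_pairs V -> #|e| = 2%N.
Proof. by rewrite inE => /eqP. Qed.

Definition complete_sgraph (V : finType) : sgraph :=
  SGraph (@all_pairs_card2 V).

Definition star {V : finType} (r : V) : {set {set V}} :=
  [set e in all_pairs V | r \in e].

Lemma set2_in_all_pairs (V : finType) (x y : V) :
  ([set x; y] \in all_pairs V) = (x != y).
Proof. by rewrite inE cards2; case: (x != y). Qed.

Lemma set2_in_star (V : finType) (r x y : V) :
  ([set x; y] \in star r) = (x != y) && ((r == x) || (r == y)).
Proof. by rewrite inE set2_in_all_pairs !inE. Qed.

Lemma star_subset_pairs (V : finType) (r : V) : star r \subset all_pairs V.
Proof. by apply/subsetP => e; rewrite inE => /andP[]. Qed.

(** Indexing the edges by their leaves reduces counting them to counting vertices. *)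
Lemma starE (V : finType) (r : V) : star r = [set [set r; y] | y in [set~ r]].
Proof.
apply/setP => e; apply/idP/imsetP => [|[y]].
  rewrite 2!inE => /andP[/cards2P[x [y [ne_xy ->]]]].
  rewrite !inE => /orP[] /eqP ->; last by exists x; rewrite 1?setUC // !inE.
  by exists y => //; rewrite !inE eq_sym.
by rewrite !inE => ne_yr ->; rewrite cards2 (eq_sym r) ne_yr !inE eqxx.
Qed.

Lemma card_star (V : finType) (r : V) : #|star r| = #|V|.-1.
Proof.
rewrite starE card_in_imset ?cardsC1 // => x y; rewrite !inE => ne_xr _ eq_xy.
have: x \in [set r; y] by rewrite -eq_xy !inE eqxx orbT.
by rewrite !inE (negPf ne_xr) => /eqP.
Qed.

Lemma connected_star (V : finType) (r : V) : connected_on (star r).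
Proof.
split=> [|x y]; first by apply/card_gt0P; exists r.
have to_hub z : connect (adj (star r)) z r.
  have [->|ne_zr] := eqVneq z r; first exact: connect0.
  by apply: connect1; rewrite /adj /= set2_in_star ne_zr eqxx orbT.
have from_hub z : connect (adj (star r)) r z.
  have [->|ne_zr] := eqVneq z r; first exact: connect0.
  by apply: connect1; rewrite /adj /= set2_in_star eq_sym ne_zr eqxx.
exact: connect_trans (to_hub x) (from_hub y).
Qed.

(* In a cycle x, y, z, ... the hub lies on both xy and yz, so it is y; but then
   it is not on the edge that closes the cycle at x. *)
Lemma acyclic_star (V : finType) (r : V) : acyclic_on (star r).
Proof.
move=> [|x [|y [|z c]]] //= /andP[].
rewrite /adj /= rcons_path /= !set2_in_star.
case/and3P=> /andP[_ xy] /andP[_ yz] /andP[_ /andP[_ lx]].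
rewrite !inE !negb_or => /and3P[/and3P[ne_xy ne_xz _] /andP[ne_yz yc] _].
case/orP: xy => /eqP Dr; subst r.
  by move: yz; rewrite (negPf ne_xy) (negPf ne_xz).
case/orP: lx => /eqP Dy; last by rewrite Dy eqxx in ne_xy.
by have := mem_last z c; rewrite -Dy inE (negPf ne_yz) (negPf yc).
Qed.

Lemma spanning_tree_star (V : finType) (r : V) :
  spanning_tree (G := complete_sgraph V) (star r).
Proof.
split; [exact: star_subset_pairs|exact: connected_star|exact: acyclic_star].
Qed.

Lemma connected_complete (V : finType) (r : V) :
  connected_graph (complete_sgraph V).
Proof.
split=> [|x y]; first by apply/card_gt0P; exists r.
have [->|ne_xy] := eqVneq x y; first exact: connect0.
by apply: connect1; rewrite /adj /= set2_in_all_pairs.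
Qed.

(** The graphs of the final family are told apart by their orders alone. *)
Lemma isomorphic_card (G H : sgraph) : isomorphic G H -> #|G| = #|H|.
Proof. by case=> f bij_f _; exact: bij_eq_card bij_f. Qed.

(** This is what allows the hub to be placed in the first part of any cut. *)
Lemma edges_betweenC (G : sgraph) (A B : {set G}) :
  edges_between A B = edges_between B A.
Proof.
apply/setP => e; rewrite !inE; congr (_ && _); apply/idP/idP;
  case/existsP=> x /andP[xA /existsP[y /andP[yB /eqP De]]];
  by apply/existsP; exists y; rewrite yB; apply/existsP; exists x;
     rewrite xA De setUC eqxx.
Qed.

Lemma edges_between_complete (V : finType) (A : {set V}) :
  edges_between (G := complete_sgraph V) A (~: A) =
  [set [set p.1; p.2] | p in setX A (~: A)].
Proof.
apply/setP => e; rewrite inE; apply/andP/imsetP.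
  case=> _ /existsP[x /andP[xA /existsP[y /andP[yA /eqP De]]]].
  by exists (x, y) => //; rewrite inE xA.
case=> [[x y]] /setXP[/= xA yA] ->; rewrite set2_in_all_pairs; split.
  by apply: contraTneq yA => <-; rewrite inE xA.
by apply/existsP; exists x; rewrite xA; apply/existsP; exists y; rewrite yA eqxx.
Qed.

(** Since [A] and its complement are disjoint, a crossing edge determines which of its ends lies in
    [A]; the map from ordered pairs to edges is therefore injective on [A] times [~: A], and the sum
    can be reindexed. *)
Lemma total_weight_cut (R : realType) (V : finType) (w : {set V} -> R)
    (w_ge0 : forall e, e \in edges (complete_sgraph V) -> 0 <= w e)
    (A : {set V}) :
  total_weight (edges_between (G := WGraph w_ge0) A (~: A)) =
  \sum_(x in A) \sum_(y in ~: A) w [set x; y].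
Proof.
rewrite /total_weight edges_between_complete big_imset /=.
  by rewrite pair_big /=; apply: eq_bigl => -[x y]; rewrite in_setX.
move=> [x y] [x' y'] /setXP[/= xA yA] /setXP[/= x'A y'A] eq_e.
have xe : x \in [set x'; y'] by rewrite -eq_e !inE eqxx.
have ye : y \in [set x'; y'] by rewrite -eq_e !inE eqxx orbT.
congr pair; [case/set2P: xe => // Dx|case/set2P: ye => // Dy].
  by rewrite -Dx inE xA in y'A.
by rewrite Dy inE x'A in yA.
Qed.

Section HubGraph.

Context {R : realType} (eps : R) (eps_gt0 : 0 < eps) {V : finType} (r : V).

Definition hub_weight (e : {set V}) : R := if r \in e then 1 else eps.

Lemma hub_weight_ge0 (e : {set V}) :
  e \in edges (complete_sgraph V) -> 0 <= hub_weight e.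
Proof. by rewrite /hub_weight; case: ifP => // _; rewrite ltW. Qed.

Definition hub_graph : wgraph R :=
  WGraph (graph_of := complete_sgraph V) hub_weight_ge0.

(** The hub is not counted: [n] is the order of the clique of edges of weight [eps]. *)
Local Notation n := (#|V|.-1%:R : R).

Lemma total_weight_star : total_weight (G := hub_graph) (star r) = n.
Proof.
rewrite -(card_star r) -sumr_const; apply: eq_bigr => e.
by rewrite inE /= /hub_weight => /andP[_ ->].
Qed.

Lemma total_weight_hub :
  total_weight (edges hub_graph) = n + eps * (n * (n - 1) / 2).
Proof.
have V_gt0 : (0 < #|V|)%N by apply/card_gt0P; exists r.
rewrite /total_weight (big_setID (star r)) /= (setIidPr (star_subset_pairs r)).
congr (_ + _); first exact: total_weight_star.
rewrite (eq_bigr (fun=> eps)) => [|e]; last first.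
  by rewrite 2!inE /hub_weight andbC => /andP[->]; case: ifP.
rewrite sumr_const -[LHS]mulr_natr; congr (eps * _).
rewrite cardsD (setIidPr (star_subset_pairs r)) card_star.
have -> : #|all_pairs V| = 'C(#|V|, 2).
  rewrite -(card_draws V 2); apply: eq_card => e; by rewrite !inE.
(* By Pascal's rule, removing the [n] star edges from the C(n+1, 2) pairs leaves C(n, 2). *)
rewrite -{1}(prednK V_gt0) binS bin1 addnK.
(* The subtraction in [n - 1] is that of [R], which differs from the natural predecessor at
   [n = 0]. *)
case: (#|V|.-1) => [|m]; first by rewrite bin0n /= !mul0r.
have -> : m.+1%:R - 1 = m%:R :> R by rewrite -natr1 addrK.
have := bin_ffact m.+1 2; rewrite ffactnS ffactn1 /= => bin2_double.
by rewrite -natrM -bin2_double natrM mulfK // pnatr_eq0.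
Qed.

(** With [s] vertices away from the hub, the hub sends [s] crossing edges of weight 1, and each of
    the [n - s] other vertices of [A] sends [s] of weight [eps]. *)
Lemma hub_cut (A : {set V}) : r \in A ->
  total_weight (edges_between (G := hub_graph) A (~: A)) =
  #|~: A|%:R + eps * ((n - #|~: A|%:R) * #|~: A|%:R).
Proof.
move=> rA; rewrite total_weight_cut (big_setD1 r) //=; congr (_ + _).
  rewrite -sumr_const; apply: eq_bigr => y _.
  by rewrite /hub_weight !inE eqxx.
rewrite (eq_bigr (fun=> eps * #|~: A|%:R)) => [|x]; last first.
  rewrite !inE => /andP[ne_xr xA].
  rewrite mulr_natr -sumr_const; apply: eq_bigr => y; rewrite inE => yA.
  rewrite /hub_weight !inE eq_sym (negPf ne_xr) /=; case: eqP => // Dr.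
  by rewrite -Dr rA in yA.
rewrite sumr_const -[LHS]mulr_natr.
have -> : n = #|A :\ r|%:R + #|~: A|%:R :> R.
  by rewrite -natrD -(cardsC A) (cardsD1 r A) rA.
by ring.
Qed.

Lemma mac_hub_lt : 1 < 3 * eps ^+ 2 * n ->
  mac hub_graph < total_weight (edges hub_graph) / 2
                  + eps * total_weight (G := hub_graph) (star r).
Proof.
move=> n_big; rewrite total_weight_hub total_weight_star.
set M := (X in _ < X).
have eps4_gt0 : 0 < 4 * eps by rewrite mulr_gt0.
have cut_lt (s : R) : s + eps * ((n - s) * s) < M.
  rewrite -subr_gt0 -(pmulr_rgt0 _ eps4_gt0).
  (* Scaling the gap by [4 * eps] completes the square in [s], whose minimum is at
     [s = n / 2 + 1 / (2 * eps)]; the constant left over is positive by [n_big]. *)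
  have -> : 4 * eps * (M - (s + eps * ((n - s) * s))) =
    (2 * eps * (s - n / 2) - 1) ^+ 2 + (3 * eps ^+ 2 * n - 1) by rewrite /M; field.
  by rewrite ltr_wpDl ?sqr_ge0 // subr_gt0.
rewrite /mac; apply: (big_ind (fun z => z < M)) => [|x y xM yM|A _].
(* The default value [0] of the maximum is the case [s = 0]. *)
- by have := cut_lt 0; rewrite mulr0 mulr0 addr0.
- by rewrite gt_max xM.
have [rA|rA] := boolP (r \in A); first by rewrite hub_cut.
by rewrite edges_betweenC -{2}[A]setCK hub_cut // inE.
Qed.

End HubGraph.

Theorem theorem3p3 (R : realType) (eps : R) (eps_gt0 : 0 < eps) :
  exists G : nat -> wgraph R,
    (forall i j : nat, i <> j -> ~ isomorphic (G i) (G j)) /\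
    (forall i : nat,
       connected_graph (G i) /\
       exists T : {set {set G i}},
         spanning_tree T /\
         mac (G i) < total_weight (edges (G i)) / 2 + eps * total_weight T).
Proof.
pose c := 3 * eps ^+ 2.
have c_gt0 : 0 < c by rewrite mulr_gt0 ?exprn_gt0.
(* [N] exceeds [1 / (3 * eps ^+ 2)], the threshold on [n] in [mac_hub_lt]. *)
pose N := Num.bound c^-1.
(* The successor accounts for the hub [ord0], so that [n = N + i]: past the threshold for every [i],
   and different for different [i]. *)
exists (fun i => hub_graph eps_gt0 (ord0 : 'I_(N + i).+1)).
split=> [i j ne_ij /isomorphic_card|i].
  by rewrite !card_ord => -[] /addnI.
split; first exact: (connected_complete (V := 'I_(N + i).+1) ord0).
exists (star (ord0 : 'I_(N + i).+1)); split; first exact: spanning_tree_star.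
apply: mac_hub_lt; rewrite card_ord /= -/c mulrC -ltr_pdivrMr // mul1r.
apply: (@lt_le_trans _ _ N%:R); last by rewrite ler_nat leq_addr.
by rewrite archi_boundP // invr_ge0 ltW.
Qed.
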